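(* Let $V$ be a vector space of dimension $\ell$ over a field $\mathbf K$ of characteristic zero, and let $\Delta\subset V^*$ be a finite set of nonzero linear forms, no two of which are proportional. Let $\mathcal B$ be any $\mathbf K$-basis of the vector space $AO(\Delta)$, and let $\partial(V)_+$ be the maximal ideal of $\partial(V)$ generated by its homogeneous elements of degree one. Then: (1) $\mathcal B$ is a system of minimal generators of the $\partial(V)$-module $C(\Delta)$; (2) $C(\Delta)=\partial(V)_+C(\Delta)\oplus AO(\Delta)$; (3) $\partial(V)_+C(\Delta)=\sum_{\mathcal E\in\mathbf E^d(\Delta)}\mathbf K\,(\prod\mathcal E)^{-1}$. In particular, $\partial(V)_+C(\Delta)$ is an ideal of the ring $C(\Delta)$.
   Context: $S=S(V^* )$ is the algebra of polynomial functions on $V$ and $S_{(0)}$ its field of fractions. $C(\Delta)$ is the $\mathbf K$-subalgebra of $S_{(0)}$ generated by $\{1/\alpha:\alpha\in\Delta\}$, graded by $\deg(1/\alpha)=1$. $\partial(V)$ is the $\mathbf K$-algebra of differential operators with constant coefficients on $V$ (containing the constants $\mathbf K$); if $x_1,\dots,x_\ell$ is a basis of $V^*$, $\partial(V)=\mathbf K[\partial/\partial x_1,\dots,\partial/\partial x_\ell]$, graded with $\deg\partial/\partial x_i=1$; it acts on $S_{(0)}$ and makes $C(\Delta)$ a graded $\partial(V)$-module. $\mathbf E(\Delta)$ denotes the set of all finite tuples $\mathcal E=(\alpha_1,\dots,\alpha_p)$ ($p\ge 0$) of elements of $\Delta$ (repetitions allowed), and $\prod\mathcal E=\alpha_1\cdots\alpha_p$.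 $\mathbf E^i(\Delta)$ is the set of linearly independent tuples (in particular without repetition) and $\mathbf E^d(\Delta)$ the set of linearly dependent tuples (including any tuple with a repetition). $AO(\Delta)=\sum_{\mathcal E\in\mathbf E^i(\Delta)}\mathbf K(\prod\mathcal E)^{-1}$, a finite-dimensional graded subspace of $C(\Delta)$. *)

(* Defs.v *)
From HB Require Import structures.
From mathcomp Require Import all_boot all_order all_algebra.
From mathcomp Require Import finmap ring.
From mathcomp Require Import mpoly.

Set Implicit Arguments.
Unset Strict Implicit.
Unset Printing Implicit Defensive.

Import GRing.Theory.
Local Open Scope ring_scope.

(* The field of fractions of S(V^* ), where a basis x_1, ..., x_n of V^*      *)
(* identifies S(V^* ) with the polynomial ring K[x_1, ..., x_n].              *)
Definition ratfun (K : fieldType) (n : nat) : Type := {fraction {mpoly K[n]}}.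

HB.instance Definition _ (K : fieldType) (n : nat) :=
  GRing.Field.copy (ratfun K n) {fraction {mpoly K[n]}}.

Definition of_poly (K : fieldType) (n : nat) (p : {mpoly K[n]}) : ratfun K n :=
  FracField.tofrac p.

HB.instance Definition _ (K : fieldType) (n : nat) :=
  GRing.RMorphism.copy (@of_poly K n) (@FracField.tofrac {mpoly K[n]}).

Section RatfunAlgebra.
Variables (K : fieldType) (n : nat).
Implicit Types (a b : K) (f g : ratfun K n).

Definition ratfun_scale a f : ratfun K n := of_poly a%:MP * f.

Fact ratfun_scaleA a b f :
  ratfun_scale a (ratfun_scale b f) = ratfun_scale (a * b) f.
Proof. by rewrite /ratfun_scale mulrA mpolyCM rmorphM. Qed.

Fact ratfun_scale1 : left_id 1 ratfun_scale.
Proof. by move=> f; rewrite /ratfun_scale mpolyC1 rmorph1 mul1r. Qed.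

Fact ratfun_scaleDr : right_distributive ratfun_scale +%R.
Proof. by move=> a f g; rewrite /ratfun_scale mulrDr. Qed.

Fact ratfun_scaleDl f : {morph ratfun_scale^~ f : a b / a + b}.
Proof. by move=> a b; rewrite /ratfun_scale mpolyCD rmorphD mulrDl. Qed.

HB.instance Definition _ := GRing.Zmodule_isLmodule.Build K (ratfun K n)
  ratfun_scaleA ratfun_scale1 ratfun_scaleDr ratfun_scaleDl.

Fact ratfun_scaleAl a f g : a *: (f * g) = (a *: f) * g.
Proof. exact: mulrA. Qed.

HB.instance Definition _ :=
  GRing.Lmodule_isLalgebra.Build K (ratfun K n) ratfun_scaleAl.

End RatfunAlgebra.

Section Derivation.
Variables (K : fieldType) (n : nat).

(* The partial derivative d/dx_i on the field of fractions, by the quotient   *)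
(* rule applied to the canonical representative; [pderiv_frac] shows that the *)
(* choice of the representative is immaterial.                                *)
Definition pderiv (i : 'I_n) (f : ratfun K n) : ratfun K n :=
  let r : {ratio {mpoly K[n]}} := repr (f : {fraction {mpoly K[n]}}) in
  of_poly ((\n_r)^`M(i) * \d_r - \n_r * (\d_r)^`M(i)) / of_poly (\d_r ^+ 2).

Lemma of_poly_eq0 (p : {mpoly K[n]}) : (of_poly p == 0) = (p == 0).
Proof. exact: tofrac_eq0. Qed.

Lemma of_poly_eq (p q : {mpoly K[n]}) : (of_poly p == of_poly q) = (p == q).
Proof. exact: tofrac_eq. Qed.

Lemma repr_ratfun (f : ratfun K n) :
  let r : {ratio {mpoly K[n]}} := repr (f : {fraction {mpoly K[n]}}) in
  f = of_poly \n_r / of_poly \d_r.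
Proof.
move=> r; have dr0 : of_poly \d_r != 0 by rewrite of_poly_eq0 denom_ratioP.
apply: (canRL (mulfK dr0)); rewrite -[f in LHS](@reprK _ {fraction {mpoly K[n]}}).
rewrite -/r /of_poly; unlock FracField.tofrac.
rewrite -[LHS]FracField.pi_mul; apply/eqmodP.
rewrite /= FracField.equivfE /FracField.mulf.
by rewrite !numden_Ratio ?(oner_eq0, mulf_neq0, denom_ratioP) // !mulr1 mulrC.
Qed.

Fact quotient_rule_aux (A : comNzRingType) (p q u v p' q' u' v' : A) :
  p * v = u * q -> p' * v + p * v' = u' * q + u * q' ->
  (u' * v - u * v') * q ^+ 2 = (p' * q - p * q') * v ^+ 2.
Proof.
move=> e1 e2.
have -> : (u' * v - u * v') * q ^+ 2 = u' * q * (v * q) - u * q * (v' * q).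
  by ring.
have -> : u' * q = p' * v + p * v' - u * q' by rewrite e2 addrK.
have -> : (p' * v + p * v' - u * q') * (v * q)
   = p' * v * v * q + p * v * (v' * q) - u * q * (v * q') by ring.
by rewrite -e1; ring.
Qed.

Lemma pderiv_frac (i : 'I_n) (p q : {mpoly K[n]}) : q != 0 ->
  pderiv i (of_poly p / of_poly q)
  = of_poly (p^`M(i) * q - p * q^`M(i)) / of_poly (q ^+ 2).
Proof.
move=> q0; rewrite /pderiv; set r := repr _.
have d0 : \d_r != 0 by exact: denom_ratioP.
have /eqP := repr_ratfun (of_poly p / of_poly q); rewrite -/r.
rewrite eqr_div ?of_poly_eq0 // -!rmorphM of_poly_eq => /eqP pd_nq.
apply/eqP; rewrite eqr_div ?of_poly_eq0 ?expf_neq0 // -!rmorphM of_poly_eq.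
have := congr1 (mderiv i) pd_nq; rewrite !mderivM => dpd_nq.
by apply/eqP; exact: quotient_rule_aux pd_nq dpd_nq.
Qed.

(* d^m = prod_i (d/dx_i)^(m i), compare [mderivm]. *)
Definition pderivm (m : 'X_{1..n}) (f : ratfun K n) : ratfun K n :=
  foldr (fun i => iter (m i) (pderiv i)) f (enum 'I_n).

(* The algebra of differential operators with constant coefficients is the    *)
(* polynomial ring {mpoly K[n]}, with 'X_i standing for d/dx_i; this is its   *)
(* action on the field of fractions.                                          *)
Definition dact (P : {mpoly K[n]}) (f : ratfun K n) : ratfun K n :=
  \sum_(m <- msupp P) P@_m *: pderivm m f.

End Derivation.

Section Subspaces.
Variables (K : fieldType) (n : nat).
Local Notation T := (ratfun K n).
Local Notation dV := {mpoly K[n]}.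
Implicit Types (X Y : T -> Prop) (f : T).

Definition Kspan X f : Prop :=
  exists2 s : seq (K * T),
    forall u, u \in s -> X u.2 & f = \sum_(u <- s) u.1 *: u.2.

Definition Kfree X : Prop :=
  forall (s : seq T) (c : T -> K), uniq s -> (forall f, f \in s -> X f) ->
    \sum_(f <- s) c f *: f = 0 -> forall f, f \in s -> c f = 0.

Definition Kbasis (W X : T -> Prop) : Prop :=
  Kfree X /\ (forall f, W f <-> Kspan X f).

Inductive Kalg X : T -> Prop :=
| Kalg_cst (c : K) : Kalg X c%:A
| Kalg_gen f of X f : Kalg X f
| Kalg_add f g of Kalg X f & Kalg X g : Kalg X (f + g)
| Kalg_mul f g of Kalg X f & Kalg X g : Kalg X (f * g).

Definition dspan X f : Prop :=
  exists2 s : seq (dV * T),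
    forall u, u \in s -> X u.2 & f = \sum_(u <- s) dact u.1 u.2.

Definition minimal_generators (M X : T -> Prop) : Prop :=
  (forall f, M f <-> dspan X f) /\
  (forall Y, (forall f, Y f -> X f) -> (forall f, M f <-> dspan Y f) ->
     forall f, X f -> Y f).

Definition dplus (P : dV) : Prop :=
  exists2 s : seq (dV * dV),
    forall u, u \in s -> u.2 \is 1.-homog & P = \sum_(u <- s) u.1 * u.2.

Definition dplus_mul (M : T -> Prop) f : Prop :=
  exists2 s : seq (dV * T),
    forall u, u \in s -> dplus u.1 /\ M u.2 & f = \sum_(u <- s) dact u.1 u.2.

Definition direct_sum (W X Y : T -> Prop) : Prop :=
  (forall f, W f <-> exists g h, [/\ X g, Y h & f = g + h]) /\
  (forall f, X f -> Y f -> f = 0).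

Definition ideal_of (A I : T -> Prop) : Prop :=
  [/\ forall f, I f -> A f, I 0, forall f g, I f -> I g -> I (f - g)
    & forall f g, A f -> I g -> I (f * g)].

End Subspaces.

Section Arrangement.
Variables (K : fieldType) (V : vectType K) (n : nat).
Variables (x : n.-tuple 'Hom(V, K^o)) (Delta : {fset 'Hom(V, K^o)}).

(* The linear form a, written in the coordinates x, as an element of S(V^* ). *)
Definition linform (a : 'Hom(V, K^o)) : {mpoly K[n]} :=
  \sum_(i < n) coord x i a *: 'X_i.

Definition inv_prod (E : seq 'Hom(V, K^o)) : ratfun K n :=
  (\prod_(a <- E) of_poly (linform a))^-1.

Definition tuple_in (E : seq 'Hom(V, K^o)) : Prop := {subset E <= Delta}.

Definition recip_alg : ratfun K n -> Prop :=
  Kalg (fun f => exists2 a, a \in Delta & f = (of_poly (linform a))^-1).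

Definition AO : ratfun K n -> Prop :=
  Kspan (fun f => exists E, [/\ tuple_in E, free E & f = inv_prod E]).

Definition dep_span : ratfun K n -> Prop :=
  Kspan (fun f => exists E, [/\ tuple_in E, ~~ free E & f = inv_prod E]).

End Arrangement.

(* Main.v *)
Require Import Defs.
From HB Require Import structures.
From mathcomp Require Import all_boot all_order all_algebra.
From mathcomp Require Import finmap ring.
From mathcomp Require Import mpoly.

Import GRing.Theory.
Local Open Scope ring_scope.

(* [C] is spanned by the inverse products [1 / prod E], and a derivative of   *)
(* such a product repeats one of its factors; hence [dplus_mul C] lies in     *)
(* [dep_span]. Conversely a relation [a = sum k_b b] gives                    *)
(* [1 / prod E = sum k_b / prod (a :: E - b)]; choosing [a] to come before    *)
(* the [b]'s in a fixed enumeration of [Delta], the exchange terminates and   *)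
(* writes any dependent [1 / prod E] as a combination of [1 / prod F] where   *)
(* the set of forms in [F] is independent and some [a] is repeated.           *)
(* Differentiating along a vector dual to [a] then exhibits [1 / prod F] as a *)
(* derivative, in characteristic zero.                                        *)
(*                                                                            *)
(* The sum is direct because a linear relation between inverse products       *)
(* splits: translating to infinity along vectors killed by a subspace [W]     *)
(* keeps exactly the terms with [E] inside [W]; for [W] minimal among the     *)
(* spans occurring in the relation these terms all span [W], and their part   *)
(* of least degree [dim W] consists of the independent ones. So the           *)
(* independent terms of a relation already sum to zero.                       *)

(** Let D be the span of the dependent inverse products ([dep_span]). Sorting tuples into
    independent and dependent ones gives C = AO + D ([recip_alg_split]), and everything else rests
    on two facts: D = [dplus_mul C] and AO meets D only in 0.

    The inclusion of [dplus_mul C] in D is [dplus_mul_dep]. The converse [dep_dplus_mul] combines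
    the exchange ([dep_span_repeated]) with integration of a repeated form ([inv_prod_dirder]). That
    the sum is direct ([AO_dep_eq0]) comes from the splitting of relations ([free_part_eq0]). D is
    an ideal because a tuple containing a dependent tuple is dependent.

    For generation, integrating away repeated forms one at a time leaves derivatives of independent
    inverse products ([recip_alg_pderivm]). Minimality is an argument of Nakayama type: modulo D an
    operator acts through its constant term ([dact_dep]), so an expression of a basis element of AO
    over generators in the basis reduces to a linear combination of these, and freeness makes the
    element one of them ([basis_minimal]). *)

Section QuotientRule.
Variable F : fieldType.
Implicit Types p q r s : F.

Fact quotient_ruleD {p q r s p' q' r' s' : F} : q != 0 -> s != 0 ->
  ((p' * s + p * s' + (r' * q + r * q')) * (q * s)
     - (p * s + r * q) * (q' * s + q * s')) / (q * s) ^+ 2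
  = (p' * q - p * q') / q ^+ 2 + (r' * s - r * s') / s ^+ 2.
Proof. by move=> q0 s0; field; rewrite q0 s0. Qed.

Fact quotient_ruleM {p q r s p' q' r' s' : F} : q != 0 -> s != 0 ->
  ((p' * r + p * r') * (q * s) - p * r * (q' * s + q * s')) / (q * s) ^+ 2
  = (p' * q - p * q') / q ^+ 2 * (r / s) + p / q * ((r' * s - r * s') / s ^+ 2).
Proof. by move=> q0 s0; field; rewrite q0 s0. Qed.

(** Expanding both orders on [f * q] by Leibniz produces the same cross terms; after cancelling them
    and the terms in [q], the nonzero factor [q] can be removed. With [q] a denominator of [f],
    commutation on fractions reduces to polynomials. *)
Fact derivation_commute {D1 D2 : F -> F} {f q : F} :
  {morph D1 : a b / a + b} -> {morph D2 : a b / a + b} ->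
  (forall a b, D1 (a * b) = D1 a * b + a * D1 b) ->
  (forall a b, D2 (a * b) = D2 a * b + a * D2 b) ->
  q != 0 -> D1 (D2 q) = D2 (D1 q) -> D1 (D2 (f * q)) = D2 (D1 (f * q)) ->
  D1 (D2 f) = D2 (D1 f).
Proof.
move=> D1D D2D D1M D2M q0 q12; rewrite D1M D2M D1D D2D !D1M !D2M q12.
rewrite !addrA => /addIr; rewrite -!addrA [D1 f * _ + _]addrC => /addIr.
exact: (mulIf q0).
Qed.

End QuotientRule.

Section Derivation.
Context {K : fieldType} {n : nat}.
Implicit Types (f g : ratfun K n) (p q : {mpoly K[n]}) (i j : 'I_n).

Lemma ratfunP f : exists p q, q != 0 /\ f = of_poly p / of_poly q.
Proof.
have := repr_ratfun f; set r := repr _ => /= fE.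
by exists \n_r, \d_r; split; first exact: denom_ratioP.
Qed.

Lemma ratfun_scaleE (c : K) f : c *: f = of_poly c%:MP * f.
Proof. by []. Qed.

Lemma ratfun_scalerAr (c : K) f g : c *: (f * g) = f * (c *: g).
Proof. by rewrite !ratfun_scaleE mulrCA. Qed.

Lemma pderiv_poly i p : pderiv i (of_poly p) = of_poly p^`M(i).
Proof.
have := pderiv_frac i p (oner_neq0 _ : (1 : {mpoly K[n]}) != 0).
by rewrite -mpolyC1 mderivC mulr0 subr0 expr1n mpolyC1 rmorph1 mulr1 !divr1.
Qed.

Lemma pderivD i f g : pderiv i (f + g) = pderiv i f + pderiv i g.
Proof.
have [p [q [q0 ->]]] := ratfunP f; have [r [s [s0 ->]]] := ratfunP g.
rewrite addf_div ?of_poly_eq0 // -!rmorphM -rmorphD !pderiv_frac ?mulf_neq0 //.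
rewrite !(mderivD, mderivM) !(rmorphB, rmorphXn, rmorphD, rmorphM) /=.
by apply: quotient_ruleD; rewrite of_poly_eq0.
Qed.

Lemma pderivM i f g : pderiv i (f * g) = pderiv i f * g + f * pderiv i g.
Proof.
have [p [q [q0 ->]]] := ratfunP f; have [r [s [s0 ->]]] := ratfunP g.
rewrite mulf_div -!rmorphM !pderiv_frac ?mulf_neq0 //.
rewrite !(mderivD, mderivM) !(rmorphB, rmorphXn, rmorphD, rmorphM) /=.
by apply: quotient_ruleM; rewrite of_poly_eq0.
Qed.

Lemma pderivZ i (c : K) f : pderiv i (c *: f) = c *: pderiv i f.
Proof. by rewrite !ratfun_scaleE pderivM pderiv_poly mderivC rmorph0 mul0r add0r. Qed.

Lemma pderiv0 i : pderiv i (0 : ratfun K n) = 0.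
Proof. by have := pderivZ i 0 0; rewrite !scale0r. Qed.

Lemma pderiv_sum i (I : Type) (r : seq I) (P : pred I) (F : I -> ratfun K n) :
  pderiv i (\sum_(k <- r | P k) F k) = \sum_(k <- r | P k) pderiv i (F k).
Proof. exact: (big_morph _ (pderivD i) (pderiv0 i)). Qed.

Lemma pderivC i j f : pderiv i (pderiv j f) = pderiv j (pderiv i f).
Proof.
have [p [q [q0 fE]]] := ratfunP f; have q0' : of_poly q != 0 by rewrite of_poly_eq0.
have fq : f * of_poly q = of_poly p by rewrite fE divfK.
apply: (@derivation_commute (ratfun K n) (pderiv i) (pderiv j) f (of_poly q)
  (pderivD i) (pderivD j) (pderivM i) (pderivM j) q0').
  by rewrite !pderiv_poly mderiv_comm.
by rewrite fq !pderiv_poly mderiv_comm.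
Qed.

Lemma iter_pderivC i j k f :
  pderiv i (iter k (pderiv j) f) = iter k (pderiv j) (pderiv i f).
Proof. by elim: k => //= k IHk; rewrite pderivC IHk. Qed.

Lemma pderivmZD m (c : K) f g : pderivm m (c *: f + g) = c *: pderivm m f + pderivm m g.
Proof.
rewrite /pderivm; elim: (enum _) => //= i s ->.
by elim: (m i) => //= k ->; rewrite pderivD pderivZ.
Qed.

Lemma pderivm_comb m (s : seq (K * ratfun K n)) :
  pderivm m (\sum_(u <- s) u.1 *: u.2) = \sum_(u <- s) u.1 *: pderivm m u.2.
Proof.
elim: s => [|u s IHs]; last by rewrite !big_cons pderivmZD IHs.
by have := pderivmZD m (-1) 0 0; rewrite !big_nil !scaleN1r !addNr.
Qed.

Lemma pderivm0 f : pderivm 0%MM f = f.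
Proof. by rewrite /pderivm; elim: (enum _) => //= i s ->; rewrite mnm0E. Qed.

Lemma pderivmSU m i f : pderivm (m + U_(i))%MM f = pderiv i (pderivm m f).
Proof.
(* Stated for any duplicate-free list, so that the extra derivative is counted once if [i] occurs
   and not at all otherwise. *)
have aux s : uniq s ->
    foldr (fun j => iter ((m + U_(i))%MM j) (pderiv j)) f s =
    iter (i \in s) (pderiv i) (foldr (fun j => iter (m j) (pderiv j)) f s).
  elim: s => //= j s IHs /andP[js us]; rewrite {}IHs // mnmDE mnm1E inE.
  case: (eqVneq i j) js => [<- /negPf js|ij _]; last first.
    by rewrite addn0; case: (i \in s); rewrite //= iter_pderivC.
  by rewrite js addn1.
by rewrite /pderivm aux ?enum_uniq // mem_enum.
Qed.

Lemma pderivm_neq0 m f : m != 0%MM -> exists i m', pderivm m f = pderiv i (pderivm m' f).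
Proof.
move=> m0; have [i mi] : exists i, m i != 0%N.
  apply/existsP; apply: contraNT m0 => /existsPn m0; apply/eqP/mnmP => i.
  by rewrite mnm0E; apply/eqP; rewrite -[_ == _]negbK m0.
exists i, (m - U_(i))%MM; rewrite -pderivmSU submK //.
by apply/mnm_lepP => j; rewrite mnm1E; case: eqVneq => // <-; rewrite lt0n.
Qed.

Lemma pderivmU i f : pderivm U_(i)%MM f = pderiv i f.
Proof. by rewrite -[U_(i)%MM]add0m pderivmSU pderivm0. Qed.

Lemma dactZX (c : K) m f : dact (c *: 'X_[m]) f = c *: pderivm m f.
Proof.
rewrite /dact; have [->|c0] := eqVneq c 0; first by rewrite scale0r msupp0 big_nil scale0r.
by rewrite msuppMCX // big_seq1 mcoeffZ mcoeffX eqxx mulr1.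
Qed.

Lemma dactX i f : dact 'X_i f = pderiv i f.
Proof. by rewrite -['X_i]scale1r dactZX scale1r pderivmU. Qed.

Lemma dactZ P (c : K) f : dact P (c *: f) = c *: dact P f.
Proof.
rewrite /dact scaler_sumr; apply: eq_bigr => m _; rewrite !scalerA mulrC -scalerA.
by congr (_ *: _); have := pderivm_comb m [:: (c, f)]; rewrite !big_seq1.
Qed.

End Derivation.

(** * Sequences with repetitions *)

Section Duplicates.
Context {T : eqType}.
Implicit Types (a : T) (s : seq T).

(** Since [rem] deletes a single occurrence, [a \in rem a s] expresses that [a] occurs at least
    twice. *)
Lemma not_uniq_rem s : ~~ uniq s -> exists2 a, a \in s & a \in rem a s.
Proof.
elim: s => //= a s IHs; rewrite negb_and negbK => /orP[as_|/IHs[b bs bs']].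
  by exists a; rewrite ?mem_head //= eqxx.
exists b; first by rewrite inE bs orbT.
by rewrite /=; case: eqP => // _; rewrite inE bs' orbT.
Qed.

Lemma mem_rem_dup a s : a \in rem a s -> rem a s =i s.
Proof.
move=> ars b; apply/idP/idP; first exact: mem_rem.
by rewrite (perm_mem (perm_to_rem (mem_rem ars))) inE => /predU1P[->|].
Qed.

Lemma perm_undup_rem a s : a \in rem a s -> perm_eq (undup (rem a s)) (undup s).
Proof.
move=> ars; apply: uniq_perm; rewrite ?undup_uniq // => b.
by rewrite !mem_undup mem_rem_dup.
Qed.

End Duplicates.

(** * Linear spans of rational functions *)

Section Span.
Context {K : fieldType} {n : nat}.
Implicit Types (X Y : ratfun K n -> Prop) (f g : ratfun K n).

Lemma Kspan0 X : Kspan X 0.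
Proof. by exists [::]; rewrite ?big_nil. Qed.

Lemma KspanD X f g : Kspan X f -> Kspan X g -> Kspan X (f + g).
Proof.
move=> [s sX ->] [r rX ->]; exists (s ++ r); last by rewrite big_cat.
by move=> u; rewrite mem_cat => /orP[/sX|/rX].
Qed.

Lemma KspanZ X (c : K) f : Kspan X f -> Kspan X (c *: f).
Proof.
move=> [s sX ->]; exists [seq (c * u.1, u.2) | u <- s].
  by move=> _ /mapP[u us ->]; exact: (sX _ us).
by rewrite big_map scaler_sumr; apply: eq_bigr => u _; rewrite scalerA.
Qed.

Lemma KspanB X f g : Kspan X f -> Kspan X g -> Kspan X (f - g).
Proof. by move=> Xf Xg; rewrite -scaleN1r; apply/KspanD/KspanZ. Qed.

Lemma Kspan_gen X f : X f -> Kspan X f.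
Proof.
move=> Xf; exists [:: (1, f)]; last by rewrite big_seq1 scale1r.
by move=> u; rewrite inE => /eqP->.
Qed.

Lemma Kspan_sum X (I : eqType) (r : seq I) (F : I -> ratfun K n) :
  (forall i, i \in r -> Kspan X (F i)) -> Kspan X (\sum_(i <- r) F i).
Proof.
elim: r => [|i r IHr] XF; first by rewrite big_nil; exact: Kspan0.
rewrite big_cons; apply: KspanD; first by apply: XF; rewrite mem_head.
by apply: IHr => j jr; apply: XF; rewrite inE jr orbT.
Qed.

Lemma Kspan_comb X (s : seq (K * ratfun K n)) :
  (forall u, u \in s -> Kspan X u.2) -> Kspan X (\sum_(u <- s) u.1 *: u.2).
Proof. by move=> sX; apply: Kspan_sum => u /sX; exact: KspanZ. Qed.

Lemma Kspan_sub X Y : (forall f, X f -> Kspan Y f) ->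
  forall f, Kspan X f -> Kspan Y f.
Proof. by move=> XY f [s sX ->]; apply: Kspan_comb => u /sX/XY. Qed.

Lemma Kspan_pderiv X i : (forall f, X f -> Kspan X (pderiv i f)) ->
  forall f, Kspan X f -> Kspan X (pderiv i f).
Proof.
move=> dX f [s sX ->]; rewrite pderiv_sum; apply: Kspan_sum => u /sX/dX.
by rewrite pderivZ; exact: KspanZ.
Qed.

End Span.

(** * Inverse products of linear forms: derivatives and exchange *)

Section LinearForms.
Context {K : fieldType} {V : vectType K} {n : nat}.
Context {x : n.-tuple 'Hom(V, K^o)} (basis_x : basis_of fullv x).
Local Notation U := 'Hom(V, K^o).
Implicit Types (a b : U) (E F : seq U) (v : 'I_n -> K).

Local Notation ell a := (of_poly (linform x a)).

(** The value of the form [a] at the vector of V on which the coordinate forms [x] take the values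
    [v]. *)
Definition pairing v a : K := \sum_i coord x i a * v i.

(** Biduality: a functional on the space of forms is evaluation at a vector. Dual vectors and
    kernels are produced in this way. *)
Lemma scalar_pairing (f : {scalar U}) a : pairing (fun i => f x`_i) a = f a.
Proof.
rewrite [in RHS](coord_basis basis_x (memvf a)) linear_sum /=.
by apply: eq_bigr => i _; rewrite linearZ.
Qed.

Lemma linform_comb (I : Type) (r : seq I) (k : I -> K) (F : I -> U) :
  linform x (\sum_(i <- r) k i *: F i) = \sum_(i <- r) k i *: linform x (F i).
Proof.
rewrite /linform; under [RHS]eq_bigr do rewrite scaler_sumr.
rewrite exchange_big; apply: eq_bigr => j _ /=.
rewrite linear_sum /= scaler_suml; apply: eq_bigr => i _.
by rewrite linearZ scalerA.
Qed.

Lemma linform_eq0 a : (linform x a == 0) = (a == 0).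
Proof.
apply/eqP/eqP => [a0|->]; last first.
  by rewrite /linform big1 // => i _; rewrite linear0 scale0r.
rewrite (coord_basis basis_x (memvf a)) big1 // => i _.
have /(congr1 (mcoeff U_(i))) := a0; rewrite mcoeff0 linear_sum /= (bigD1 i) //=.
rewrite mcoeffZ mcoeffX eqxx mulr1 big1 ?addr0 => [->|j ji]; first exact: scale0r.
by rewrite mcoeffZ mcoeffX eq_mnm1 (negPf ji) mulr0.
Qed.

Lemma ell_neq0 a : a != 0 -> ell a != 0.
Proof. by rewrite of_poly_eq0 linform_eq0. Qed.

Lemma inv_prod_cons a E : inv_prod x (a :: E) = (ell a)^-1 * inv_prod x E.
Proof. by rewrite /inv_prod big_cons invfM. Qed.

Lemma inv_prod_cat E F : inv_prod x (E ++ F) = inv_prod x E * inv_prod x F.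
Proof. by rewrite /inv_prod big_cat invfM. Qed.

Lemma inv_prod_perm E F : perm_eq E F -> inv_prod x E = inv_prod x F.
Proof. by move=> EF; congr (_^-1); exact: perm_big. Qed.

Definition dirder v (f : ratfun K n) : ratfun K n := \sum_i v i *: pderiv i f.

Lemma dirderM v f g : dirder v (f * g) = dirder v f * g + f * dirder v g.
Proof.
rewrite /dirder mulr_suml mulr_sumr -big_split; apply: eq_bigr => i _ /=.
by rewrite pderivM scalerDr scalerAl; congr (_ + _); exact: ratfun_scalerAr.
Qed.

Lemma dirder_poly v p : dirder v (of_poly p) = of_poly (\sum_i v i *: p^`M(i)).
Proof.
rewrite rmorph_sum; apply: eq_bigr => i _.
by rewrite pderiv_poly ratfun_scaleE -rmorphM mul_mpolyC.
Qed.

Lemma mderiv_linform i a : (linform x a)^`M(i) = (coord x i a)%:MP.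
Proof.
rewrite /linform linear_sum (bigD1 i) //= big1 => [|j ji].
  rewrite addr0 mderivZ mderivX mnm1E eqxx scale1r -[X in (X - _)%MM]add0m addmK.
  by rewrite mpolyX0 -mul_mpolyC mulr1.
by rewrite mderivZ mderivX mnm1E (negPf ji) scale0r scaler0.
Qed.

Lemma dirder_ell v a : dirder v (ell a) = of_poly (pairing v a)%:MP.
Proof.
rewrite dirder_poly /pairing (raddf_sum (@mpolyC n K)); congr of_poly.
by apply: eq_bigr => i _; rewrite mderiv_linform -mul_mpolyC /= mpolyCM mulrC.
Qed.

Lemma dirderV v f : f != 0 -> dirder v f^-1 = - (dirder v f * f^-1 * f^-1).
Proof.
move=> f0; apply: (mulfI f0); apply/eqP; rewrite mulrN mulrCA divff // mulr1.
rewrite -addr_eq0 addrC -dirderM divff // -(rmorph1 (@of_poly K n)) dirder_poly.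
by rewrite big1 ?rmorph0 // => i _; rewrite -mpolyC1 mderivC scaler0.
Qed.

(** Logarithmic derivative: the factor [1 / b] contributes [- b(v) / b], which repeats [b]. *)
Lemma dirder_inv_prod v E : {in E, forall a, a != 0} ->
  dirder v (inv_prod x E) = - \sum_(b <- E) pairing v b *: inv_prod x (b :: E).
Proof.
elim: E => [|a E IHE] E0.
  rewrite big_nil oppr0 /inv_prod big_nil invr1 -(rmorph1 (@of_poly K n)) dirder_poly.
  by rewrite big1 ?rmorph0 // => i _; rewrite -mpolyC1 mderivC scaler0.
have a0 : ell a != 0 by rewrite ell_neq0 ?E0 ?mem_head.
rewrite inv_prod_cons dirderM dirderV // IHE; last first.
  by move=> b bE; rewrite E0 // inE bE orbT.
rewrite big_cons opprD mulNr mulrN dirder_ell; congr (- _ - _).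
  by rewrite !inv_prod_cons ratfun_scaleE !mulrA.
rewrite mulr_sumr; apply: eq_bigr => b _.
by rewrite -ratfun_scalerAr !inv_prod_cons mulrCA.
Qed.

Lemma inv_prod_exchange a b E : a != 0 -> b != 0 -> b \in E ->
  inv_prod x (a :: rem b E) = ell b / ell a * inv_prod x E.
Proof.
move=> a0 b0 bE; rewrite (inv_prod_perm _ _ (perm_to_rem bE)) !inv_prod_cons.
by rewrite [RHS]mulrA (mulrAC (ell b)) divff ?ell_neq0 // mul1r.
Qed.

Lemma not_free_split E : ~~ free E ->
  exists E1 a E2, E = E1 ++ a :: E2 /\ a \in <<E2>>%VS.
Proof.
elim: E => [|a E IHE]; first by rewrite nil_free.
rewrite free_cons negb_and negbK => /orP[aE|/IHE[E1 [b [E2 [-> bE2]]]]].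
  by exists [::], a, E.
by exists (a :: E1), b, E2.
Qed.

(* The set of repeated forms is independent, so a dual vector of one of them  *)
(* differentiates [F] minus one copy of it back to a multiple of [F].         *)
Lemma inv_prod_dirder F : [pchar K] =i pred0 -> {in F, forall a, a != 0} ->
  free (undup F) -> ~~ uniq F ->
  exists a v (c : K), [/\ a \in F, perm_eq (undup (rem a F)) (undup F)
    & inv_prod x F = c *: dirder v (inv_prod x (rem a F))].
Proof.
move=> charK F0 freeF nuF.
have [a aF aF'] := not_uniq_rem _ nuF.
have au : a \in undup F by rewrite mem_undup.
pose X := in_tuple (undup F).
have ia : (index a (undup F) < size (undup F))%N by rewrite index_mem.
pose i := Ordinal ia; pose v j := coord X i x`_j.
have vE b : b \in F -> pairing v b = (b == a)%:R.
  rewrite -mem_undup => bu; rewrite (scalar_pairing (coord X i)).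
  have ib : (index b (undup F) < size (undup F))%N by rewrite index_mem.
  have := coord_free (Ordinal ib) i (freeF : free X); rewrite /= nth_index // => ->.
  by rewrite -val_eqE /= (inj_in_eq (@index_inj _ a (undup F))) // -index_mem.
(* [v] is dual to [a], so only the [N] remaining copies of [a] contribute to the derivative of
   [1 / prod (rem a F)], which is [- N / prod F]. As [a] is repeated, [N] is positive, hence
   invertible in characteristic zero. *)
pose N := count_mem a (rem a F).
have N0 : (N%:R : K) != 0.
  by move/pcharf0P: charK => ->; rewrite -lt0n -has_count has_pred1.
have sF : {subset rem a F <= F} by exact: mem_rem.
exists a, v, (- N%:R^-1); split=> //.
  exact: perm_undup_rem.
rewrite dirder_inv_prod; last by move=> b /sF/F0.
suff -> : \sum_(b <- rem a F) pairing v b *: inv_prod x (b :: rem a F)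
          = N%:R *: inv_prod x F by rewrite scaleNr scalerN opprK scalerA mulVf ?scale1r.
rewrite (inv_prod_perm _ _ (perm_to_rem aF)) /N -sum1_count natr_sum scaler_suml.
rewrite [RHS]big_mkcond /= big_seq [RHS]big_seq; apply: eq_bigr => b /sF/vE->.
by case: eqVneq => [->|]; rewrite ?scale0r.
Qed.

Variables (Delta : {fset U}) (Delta0 : forall a, a \in Delta -> a != 0).

(** Once the distinct forms are sorted by position in [Delta], some [a] lies in the span of strictly
    later ones. Dividing [a = sum k_b b] by [a] times the product of [E] gives the identity. *)
Lemma dep_exchange E : {subset E <= Delta} -> ~~ free (undup E) ->
  exists a (k : U -> K) s, [/\ a \in E,
    {in s, forall b, b \in E /\ (index a Delta < index b Delta)%N}
    & inv_prod x E = \sum_(b <- s) k b *: inv_prod x (a :: rem b E)].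
Proof.
move=> ED; pose r a b := (index a Delta <= index b Delta)%N.
have r_tr : transitive r by move=> a b c; exact: leq_trans.
have r_tot : total r by move=> a b; exact: leq_total.
set s := sort r (undup E); have sE : perm_eq s (undup E) by rewrite perm_sort.
rewrite -(perm_free sE) => /not_free_split[s1 [a [s2 [sdef as2]]]].
have ms b : (b \in s) = (b \in E) by rewrite (perm_mem sE) mem_undup.
have aE : a \in E by rewrite -ms sdef mem_cat mem_head orbT.
have s2E b : b \in s2 -> b \in E by rewrite -ms sdef mem_cat inE => ->; rewrite !orbT.
have us : uniq (a :: s2).
  have : uniq s by rewrite (perm_uniq sE) undup_uniq.
  by rewrite sdef cat_uniq => /and3P[].
have a0 := Delta0 _ (ED _ aE).
(* The coefficients are indexed by forms instead of positions, which is unambiguous because [s2] has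
   no repetition; the value 0 off [s2] is a mere default. *)
pose X := in_tuple s2; pose k b := if insub (index b s2) is Some i then coord X i a else 0.
have aE2 : a = \sum_(b <- s2) k b *: b.
  rewrite [LHS](coord_span (as2 : a \in <<X>>%VS)) (big_nth 0) big_mkord.
  apply: eq_bigr => i _; congr (_ *: _).
  have /andP[_ us2] := us; rewrite /k index_uniq //; case: insubP => [j _ ji|]; last first.
    by rewrite ltn_ord.
  by congr (coord X _ a); apply: val_inj; rewrite /= ji.
exists a, k, s2; split=> // [b bs2|].
  split; first exact: s2E.
  have : sorted r s by exact: sort_sorted.
  rewrite sorted_pairwise // sdef pairwise_cat /= => /and3P[_ _ /andP[/allP/(_ _ bs2) rab _]].
  rewrite ltn_neqAle; apply/andP; split=> //; apply: contraTneq us => iab /=.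
  suff -> : a = b by rewrite bs2.
  exact: (@index_inj _ a Delta a b (ED _ aE) (ED _ (s2E _ bs2)) iab).
rewrite big_seq; transitivity (\sum_(b <- s2 | b \in s2) (k b *: ell b) / ell a * inv_prod x E).
  rewrite -!mulr_suml -big_seq; suff -> : \sum_(b <- s2) k b *: ell b = ell a.
    by rewrite divff ?ell_neq0 // mul1r.
  rewrite [in RHS]aE2 linform_comb rmorph_sum; apply: eq_bigr => b _.
  by rewrite ratfun_scaleE -mul_mpolyC rmorphM.
apply: eq_bigr => b bs2; have bE := s2E _ bs2.
by rewrite inv_prod_exchange ?Delta0 ?ED // -!scalerAl.
Qed.

(** Replacing [b] by the earlier [a] lowers the sum of the positions in [Delta], so the exchange
    terminates. It stops when [undup E] is free, and then only a repetition can make [E]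
    dependent. *)
Lemma dep_span_repeated E : {subset E <= Delta} -> ~~ free E ->
  Kspan (fun f => exists F, [/\ {subset F <= Delta}, free (undup F), ~~ uniq F
           & f = inv_prod x F]) (inv_prod x E).
Proof.
have [N] := ubnP (\sum_(a <- E) index a Delta).
elim: N E => // N IHN E ltEN ED depE; case freeE: (free (undup E)).
  apply: Kspan_gen; exists E; split=> //.
  by apply: contraNN depE => /undup_id <-.
have [a [k [s [aE sE ->]]]] := dep_exchange _ ED (negbT freeE).
apply: Kspan_sum => b /sE[bE ab]; apply: KspanZ; apply: IHN.
- move: ltEN; rewrite (perm_big _ (perm_to_rem bE)) !big_cons /= ltnS => leEN.
  by rewrite (leq_trans _ leEN) // ltn_add2r.
- by move=> c; rewrite inE => /predU1P[->|/mem_rem]; [exact: ED|exact: ED].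
(* Since [a] differs from [b], it survives in [rem b E]; the new tuple repeats [a] and is again
   dependent. *)
- have: a \in rem b E; last by rewrite free_cons => aE'; rewrite negb_and negbK memv_span.
  have := aE; rewrite (perm_mem (perm_to_rem bE)) inE => /predU1P[e|//].
  by move: ab; rewrite e ltnn.
Qed.

End LinearForms.

(** * Specialization of fractions *)

(* [place f g]: the fraction [f] over [R] is regular at the point [phi], with *)
(* value [g] there.                                                           *)
Section Place.
Context {R : comNzRingType} {F L : fieldType}.
Context (i : {rmorphism R -> F}) (phi : {rmorphism R -> L}).
Hypothesis i_inj : injective i.

Definition place (f : F) (g : L) : Prop :=
  exists N D, [/\ phi D != 0, f * i D = i N & g * phi D = phi N].

Lemma placeR r : place (i r) (phi r).
Proof. by exists r, 1; rewrite !rmorph1 oner_neq0 !mulr1. Qed.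

Lemma placeM f g f' g' : place f g -> place f' g' -> place (f * f') (g * g').
Proof.
move=> [N [D [D0 fN gN]]] [N' [D' [D0' fN' gN']]].
exists (N * N'), (D * D'); rewrite !rmorphM mulf_neq0 // -fN -gN -fN' -gN'.
by split=> //; rewrite mulrACA.
Qed.

Lemma placeD f g f' g' : place f g -> place f' g' -> place (f + f') (g + g').
Proof.
move=> [N [D [D0 fN gN]]] [N' [D' [D0' fN' gN']]].
exists (N * D' + N' * D), (D * D'); rewrite !(rmorphD, rmorphM) -fN -gN -fN' -gN'.
by split; [exact: mulf_neq0|ring|ring].
Qed.

Lemma place_neq0 r : phi r != 0 -> i r != 0.
Proof. by apply: contraNneq => ir0; rewrite (i_inj r 0) ?rmorph0. Qed.

Lemma placeV f g : g != 0 -> place f g -> place f^-1 g^-1.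
Proof.
move=> g0 [N [D [D0 fN gN]]]; exists D, N.
have N0 : phi N != 0 by rewrite -gN mulf_neq0.
have f0 : f != 0 by have := place_neq0 _ N0; rewrite -fN mulf_eq0 negb_or => /andP[].
by split; rewrite // -?fN -?gN mulKf.
Qed.

Lemma place0 g : place 0 g -> g = 0.
Proof.
move=> [N [D [D0 /esym/eqP]]]; rewrite mul0r -(rmorph0 i) (inj_eq i_inj) => /eqP->.
by rewrite rmorph0 => /eqP; rewrite mulf_eq0 (negPf D0) orbF => /eqP.
Qed.

Lemma place_sum (I : eqType) (r : seq I) (f : I -> F) (g : I -> L) :
  {in r, forall k, place (f k) (g k)} ->
  place (\sum_(k <- r) f k) (\sum_(k <- r) g k).
Proof.
elim: r => [|k r IHr] fg; first by rewrite !big_nil -(rmorph0 i) -(rmorph0 phi); exact: placeR.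
rewrite !big_cons; apply: placeD; first by apply: fg; rewrite mem_head.
by apply: IHr => j jr; apply: fg; rewrite inE jr orbT.
Qed.

Lemma place_prod (I : eqType) (r : seq I) (f : I -> F) (g : I -> L) :
  {in r, forall k, place (f k) (g k)} ->
  place (\prod_(k <- r) f k) (\prod_(k <- r) g k).
Proof.
elim: r => [|k r IHr] fg; first by rewrite !big_nil -(rmorph1 i) -(rmorph1 phi); exact: placeR.
rewrite !big_cons; apply: placeM; first by apply: fg; rewrite mem_head.
by apply: IHr => j jr; apply: fg; rewrite inE jr orbT.
Qed.

End Place.

(** * Limits of rational functions of a parameter t at t = 0 *)

Section LimitAtZero.
Context {F : fieldType}.
Local Notation L := {fraction {poly F}}.
Implicit Types a b c : F.

Definition cst : {rmorphism F -> L} := (@FracField.tofrac {poly F}) \o (@polyC F).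
Definition param : L := FracField.tofrac 'X.

Definition lim0 : L -> F -> Prop :=
  place (@FracField.tofrac {poly F}) (horner_eval (0 : F)).

Lemma tofrac_inj : injective (@FracField.tofrac {poly F}).
Proof. by move=> p q /eqP; rewrite tofrac_eq => /eqP. Qed.

Lemma param_neq0 : param != 0.
Proof. by rewrite tofrac_eq0 polyX_eq0. Qed.

Lemma lim0_cst c : lim0 (cst c) c.
Proof. by rewrite -[X in lim0 _ X](hornerC c 0); exact: placeR. Qed.

Lemma lim0_param : lim0 param 0.
Proof. by rewrite -[X in lim0 _ X](hornerX 0); exact: placeR. Qed.

(** Multiplication by t gives the polynomial [a t + b], whose linear coefficient is [a]. *)
Lemma affine_neq0 a b : a != 0 -> cst a + cst b / param != 0.
Proof.
apply: contraNneq => /(congr1 (fun f => f * param)).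
rewrite mul0r mulrDl divfK ?param_neq0 // /cst /= -rmorphM -rmorphD.
move=> /eqP; rewrite tofrac_eq0 => /eqP/(congr1 (fun p : {poly F} => p`_1)).
by rewrite coefD coefMX !coefC /= addr0 => ->.
Qed.

(** For nonzero [b] the function has a pole at t = 0, so its inverse [t / (a t + b)] vanishes there.
    This is what discards the forms that do not vanish at the chosen vector. *)
Lemma lim0_affineV a b : a != 0 ->
  lim0 (cst a + cst b / param)^-1 (if b == 0 then a^-1 else 0).
Proof.
move=> a0; case: eqVneq => [->|b0].
  by rewrite rmorph0 mul0r addr0; apply: placeV => //; [exact: tofrac_inj|exact: lim0_cst].
have -> : (cst a + cst b / param)^-1 = param * (cst a * param + cst b)^-1.
  rewrite -[X in _ = X * _](invrK) -invfM mulrDr mulrCA mulVf ?param_neq0 // mulr1.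
  by rewrite [_^-1 * _]mulrC.
rewrite -[X in lim0 _ X](mul0r b^-1); apply: placeM; first exact: lim0_param.
apply: placeV => //; first exact: tofrac_inj.
rewrite -[X in place _ _ _ X]add0r -[X in place _ _ _ (X + _)](mulr0 a).
by apply: placeD; [apply: placeM; [exact: lim0_cst|exact: lim0_param]|exact: lim0_cst].
Qed.

Lemma lim0_0 c : lim0 0 c -> c = 0.
Proof. by apply: place0; exact: tofrac_inj. Qed.

End LimitAtZero.

Lemma seq_argmin (T : eqType) (f : T -> nat) (s : seq T) : s != [::] ->
  exists2 a, a \in s & {in s, forall b, (f a <= f b)%N}.
Proof.
elim: s => // a [_ _|b s /(_ isT)[c cs min_c] _].
  by exists a; rewrite ?mem_head // => b; rewrite inE => /eqP->.
have [le_ac|lt_ca] := leqP (f a) (f c).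
  exists a => [|d]; first exact: mem_head.
  by rewrite inE => /predU1P[->//|/min_c]; exact: leq_trans.
exists c => [|d]; first by rewrite inE cs orbT.
by rewrite inE => /predU1P[->|/min_c//]; exact: ltnW.
Qed.

(** * Linear relations between inverse products *)

Section Independence.
Context {K : fieldType} {V : vectType K} {n : nat}.
Context {x : n.-tuple 'Hom(V, K^o)} (basis_x : basis_of fullv x).
Local Notation U := 'Hom(V, K^o).
Context {F : fieldType} (j : {rmorphism {mpoly K[n]} -> F}).
Hypothesis j_inj : injective j.
Implicit Types (a b : U) (E : seq U) (s : seq (K * seq U)) (v : 'I_n -> K).

Local Notation ell a := (j (linform x a)).
Local Notation term u := (j u.1%:MP * (\prod_(a <- u.2) ell a)^-1).

Let ell0 a : a != 0 -> ell a != 0.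
Proof. by rewrite -(linform_eq0 basis_x) -(rmorph0 j) (inj_eq j_inj). Qed.

Lemma linform_mmap (A : comNzRingType) (f : {rmorphism K -> A}) (h : 'I_n -> A) a :
  mmap f h (linform x a) = \sum_i f (coord x i a) * h i.
Proof.
by rewrite raddf_sum; apply: eq_bigr => i _; rewrite /= mmapZ mmapX mmap1U.
Qed.

Let ell_sum a : cst (ell a) = \sum_i cst (j (coord x i a)%:MP) * cst (j 'X_i).
Proof.
by rewrite !rmorph_sum; apply: eq_bigr => i _; rewrite -mul_mpolyC !rmorphM.
Qed.

Let pairing_sum v a : cst (j (pairing (x := x) v a)%:MP) =
  \sum_i cst (j (coord x i a)%:MP) * cst (j (v i)%:MP).
Proof.
rewrite (raddf_sum (@mpolyC n K)) !rmorph_sum.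
by apply: eq_bigr => i _; rewrite /= mpolyCM !rmorphM.
Qed.

Lemma place_term (A : fieldType) (phi : {rmorphism {mpoly K[n]} -> A}) (u : K * seq U) :
  {in u.2, forall a, phi (linform x a) != 0} ->
  place j phi (term u) (phi u.1%:MP * \prod_(a <- u.2) (phi (linform x a))^-1).
Proof.
move=> u0; rewrite -prodfV; apply: placeM; first exact: placeR.
by apply: place_prod => a /u0 a0; apply: placeV => //; exact: placeR.
Qed.

(** A substitution that kills none of the denominators extends to the fractions involved, and there
    the value of 0 is 0. *)
Lemma specialize_rel (A : fieldType) (phi : {rmorphism {mpoly K[n]} -> A}) s :
  {in s, forall u, {in u.2, forall a, phi (linform x a) != 0}} ->
  \sum_(u <- s) term u = 0 ->
  \sum_(u <- s) phi u.1%:MP * \prod_(a <- u.2) (phi (linform x a))^-1 = 0.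
Proof.
move=> s0 s_eq0; apply: (place0 j phi j_inj); rewrite -s_eq0.
by apply: place_sum => u /s0; exact: place_term.
Qed.

(* Substitute [x + v / t] for [x] and let [t] tend to 0. *)
Lemma restrict_ker v s : {in s, forall u, {in u.2, forall a, a != 0}} ->
  \sum_(u <- s) term u = 0 ->
  \sum_(u <- s | all (fun a => pairing (x := x) v a == 0) u.2) term u = 0.
Proof.
move=> s0 s_eq0.
pose f : {rmorphism K -> {fraction {poly F}}} := cst \o (j \o @mpolyC n K).
pose h i : {fraction {poly F}} := cst (j 'X_i) + cst (j (v i)%:MP) / param.
pose phi : {rmorphism {mpoly K[n]} -> {fraction {poly F}}} := mmap f h.
have phi_ell a : phi (linform x a) = cst (ell a) + cst (j (pairing (x := x) v a)%:MP) / param.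
  rewrite (linform_mmap _ f h a : phi _ = _) ell_sum pairing_sum mulr_suml -big_split.
  by apply: eq_bigr => i _; rewrite /= mulrDr mulrA.
have phi0 : {in s, forall u, {in u.2, forall a, phi (linform x a) != 0}}.
  move=> u us a au; rewrite phi_ell; exact/affine_neq0/ell0/(s0 u).
rewrite big_mkcond; apply: lim0_0; rewrite -(specialize_rel _ phi s phi0 s_eq0).
apply: place_sum => u us.
have lim_phi a : a \in u.2 ->
    lim0 (phi (linform x a))^-1 (if pairing (x := x) v a == 0 then (ell a)^-1 else 0).
  move=> au; rewrite phi_ell.
  have := lim0_affineV _ (j (pairing (x := x) v a)%:MP) (ell0 _ (s0 _ us _ au)).
  by rewrite -(rmorph0 j) (inj_eq j_inj) mpolyC_eq0.
have -> : phi u.1%:MP = cst (j u.1%:MP) by exact: mmapC.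
(* One form with nonzero value at [v] makes the limit of the whole product 0, so exactly the terms
   whose forms all vanish at [v] survive. *)
have -> : (if all (fun a => pairing (x := x) v a == 0) u.2 then term u else 0) =
    j u.1%:MP * \prod_(a <- u.2) (if pairing (x := x) v a == 0 then (ell a)^-1 else 0).
  elim: u.2 => [|a E IHE] /=; first by rewrite !big_nil invr1.
  rewrite !big_cons; case: eqP => _ /=; last by rewrite mul0r mulr0.
  by rewrite mulrCA -IHE invfM [in RHS](fun_if ( *%R _)) mulr0 mulrCA.
apply: placeM; [exact: lim0_cst|exact: place_prod].
Qed.

(* Substitute [x / t] for [x], multiply by [t ^ -k], and let [t] tend to 0. *)
Lemma restrict_size k s : {in s, forall u, {in u.2, forall a, a != 0}} ->
  {in s, forall u, (k <= size u.2)%N} ->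
  \sum_(u <- s) term u = 0 -> \sum_(u <- s | size u.2 == k) term u = 0.
Proof.
move=> s0 sk s_eq0.
pose f : {rmorphism K -> {fraction {poly F}}} := cst \o (j \o @mpolyC n K).
pose h i : {fraction {poly F}} := cst (j 'X_i) / param.
pose phi : {rmorphism {mpoly K[n]} -> {fraction {poly F}}} := mmap f h.
have phi_ell a : phi (linform x a) = cst (ell a) / param.
  rewrite (linform_mmap _ f h a : phi _ = _) ell_sum mulr_suml.
  by apply: eq_bigr => i _; rewrite mulrA.
have phi0 : {in s, forall u, {in u.2, forall a, phi (linform x a) != 0}}.
  move=> u us a au; rewrite phi_ell mulf_neq0 ?invr_eq0 ?param_neq0 //.
  by rewrite fmorph_eq0 ell0 // (s0 u).
rewrite big_mkcond; apply: lim0_0; rewrite -(mul0r (param ^- k)).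
rewrite -(specialize_rel _ phi s phi0 s_eq0) mulr_suml; apply: place_sum => u us.
(* Each factor [1 / a] is multiplied by t, so a term acquires [t ^ (size - k)], which tends to 0
   unless the size is [k]. *)
have -> : phi u.1%:MP * (\prod_(a <- u.2) (phi (linform x a))^-1) * param ^- k =
    cst (term u) * param ^+ (size u.2 - k).
  have -> : phi u.1%:MP = cst (j u.1%:MP) by exact: mmapC.
  have -> : \prod_(a <- u.2) (phi (linform x a))^-1 =
      cst (\prod_(a <- u.2) ell a)^-1 * param ^+ size u.2.
    elim: u.2 => [|a E IHE]; first by rewrite !big_nil invr1 rmorph1 mulr1.
    rewrite !big_cons IHE phi_ell invf_div [in RHS]invfM rmorphM (fmorphV cst (ell a)).
    by rewrite exprS [param / _]mulrC mulrACA.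
  rewrite rmorphM -!mulrA; congr (_ * (_ * _)).
  by rewrite -{1}(subnK (sk _ us)) exprD mulfK // expf_neq0 // param_neq0.
have -> : (if size u.2 == k then term u else 0) =
    term u * (0 : F) ^+ (size u.2 - k).
  have := sk _ us; rewrite leq_eqVlt eq_sym; case: eqP => [-> _|_ /= lt].
    by rewrite subnn mulr1.
  by rewrite -subn_gt0 in lt; rewrite expr0n eqn0Ngt lt mulr0.
apply: placeM; first exact: lim0_cst.
elim: (_ - k)%N => [|m IHm]; last by rewrite !exprS; apply: placeM => //; exact: lim0_param.
by rewrite !expr0 -(rmorph1 cst); exact: lim0_cst.
Qed.

(** [W] is the kernel of [g], hence the set of forms vanishing at finitely many vectors, one for
    each coordinate of [g]; [restrict_ker] is applied to them in turn. *)
Lemma restrict_span (W : {vspace U}) s : {in s, forall u, {in u.2, forall a, a != 0}} ->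
  \sum_(u <- s) term u = 0 -> \sum_(u <- s | (<<u.2>> <= W)%VS) term u = 0.
Proof.
move=> s0 s_eq0; pose g : 'End(U) := (\1 - projv W)%VF.
have gW a : (a \in W) = (g a == 0).
  rewrite add_lfunE opp_lfunE id_lfunE subr_eq0 eq_sym; apply/idP/eqP => [/projv_id//|<-].
  exact: memv_proj.
pose v k i := coord x k (g x`_i).
have vE k a : pairing (x := x) (v k) a = coord x k (g a).
  exact: (scalar_pairing basis_x (coord x k \o g)).
have restrict_kers ks : \sum_(u <- s | all (fun k =>
    all (fun a => pairing (x := x) (v k) a == 0) u.2) ks) term u = 0.
  elim: ks => [|k ks IHks]; first by rewrite big_mkcond /= in s_eq0 *.
  under eq_bigl do rewrite /= andbC; rewrite -big_filter_cond; apply: restrict_ker.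
    by move=> u; rewrite mem_filter => /andP[_]; exact: s0.
  by rewrite big_filter.
rewrite -[RHS](restrict_kers (enum 'I_n)); apply: eq_bigl => u.
apply/span_subvP/allP => [uW k _|u0 a au].
  by apply/allP => a /uW; rewrite gW vE => /eqP->; rewrite linear0.
rewrite gW (coord_basis basis_x (memvf (g a))) big1 // => k _.
have /allP/(_ a au) := u0 k (mem_enum _ k); rewrite vE => /eqP->.
exact: scale0r.
Qed.

(** Induction on the number of terms: the terms whose span is a fixed [W] of least dimension form a
    relation by themselves, and removing them leaves a shorter one. *)
Lemma free_part_eq0 s : {in s, forall u, {in u.2, forall a, a != 0}} ->
  \sum_(u <- s) term u = 0 -> \sum_(u <- s | free u.2) term u = 0.
Proof.
have [N] := ubnP (size s); elim: N s => // N IHN s ltsN s0 s_eq0.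
have [->|s_nil] := eqVneq s [::]; first by rewrite big_nil.
have [u0 u0s min_u0] := seq_argmin _ (fun u : K * seq U => \dim <<u.2>>) s s_nil.
set W := <<u0.2>>%VS in min_u0.
have W_eq0 : \sum_(u <- s | <<u.2>>%VS == W) term u = 0.
  rewrite -[RHS](restrict_span W _ s0 s_eq0) big_seq_cond [RHS]big_seq_cond.
  apply: eq_bigl => u; case us: (u \in s) => //=.
  (* By minimality of the dimension, a span contained in [W] equals [W]. *)
  by rewrite eqEdim min_u0 ?andbT.
have W'_eq0 : \sum_(u <- s | <<u.2>>%VS != W) term u = 0.
  by move: s_eq0; rewrite (bigID (fun u => <<u.2>>%VS == W)) /= W_eq0 add0r.
rewrite (bigID (fun u => <<u.2>>%VS == W)) /=.
have -> : \sum_(u <- s | free u.2 && (<<u.2>>%VS == W)) term u = 0.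
  (* A tuple spanning [W] has at least [\dim W] entries, with equality exactly when it is free. *)
  rewrite -[RHS](restrict_size (\dim W) [seq u <- s | <<u.2>>%VS == W]).
  - rewrite big_filter_cond; apply: eq_bigl => u; rewrite andbC /free.
    by case: eqP => // ->; rewrite eq_sym.
  - by move=> u; rewrite mem_filter => /andP[_]; exact: s0.
  - by move=> u; rewrite mem_filter => /andP[/eqP<- _]; exact: dim_span.
  - by rewrite big_filter.
rewrite add0r -[RHS](IHN [seq u <- s | <<u.2>>%VS != W]).
- by rewrite big_filter_cond; apply: eq_bigl => u; rewrite andbC.
- rewrite size_filter -ltnS (leq_trans _ ltsN) // ltnS.
  rewrite -(count_predC (fun u => <<u.2>>%VS != W) s) -addn1 leq_add2l -has_count.
  by apply/hasP; exists u0; rewrite //= negbK.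
- by move=> u; rewrite mem_filter => /andP[_]; exact: s0.
- by rewrite big_filter.
Qed.

End Independence.

(** * Spans under differential operators *)

Section Closure.
Context {K : fieldType} {n : nat}.
Implicit Types (X Y Z M : ratfun K n -> Prop) (f g : ratfun K n).

Lemma Kspan_mul X Y Z :
  (forall f g, X f -> Y g -> Kspan Z (f * g)) ->
  forall f g, Kspan X f -> Kspan Y g -> Kspan Z (f * g).
Proof.
move=> XYZ f g [s sX ->] [r rY ->]; rewrite mulr_suml; apply: Kspan_sum => u /sX Xu.
rewrite mulr_sumr; apply: Kspan_sum => w /rY Yw.
by rewrite -scalerAl -ratfun_scalerAr; do 2!apply: KspanZ; exact: XYZ.
Qed.

Lemma pderivm_closed X m f :
  (forall i g, X g -> X (pderiv i g)) -> X f -> X (pderivm m f).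
Proof.
move=> dX Xf; rewrite /pderivm; elim: (enum _) => //= i s Xs.
by elim: (m i) => //= k; exact: dX.
Qed.

Lemma dplus_mcoeff0 (P : {mpoly K[n]}) : dplus P -> P@_0%MM = 0.
Proof.
move=> [s s1 ->]; rewrite raddf_sum big_seq big1 // => u /s1 u1.
have u0 : u.2@_0%MM = 0 by apply: (dhomog_nemf_coeff u1); rewrite /= mdeg0.
by rewrite [LHS](rmorphM (mcoeff 0%MM)) /= u0 mulr0.
Qed.

Lemma dplusX i : dplus ('X_i : {mpoly K[n]}).
Proof.
exists [:: (1, 'X_i)] => [u|]; last by rewrite big_seq1 mul1r.
by rewrite inE => /eqP->; rewrite dhomogX /= mdeg1.
Qed.

Lemma dspanD X f g : dspan X f -> dspan X g -> dspan X (f + g).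
Proof.
move=> [s sX ->] [r rX ->]; exists (s ++ r); last by rewrite big_cat.
by move=> u; rewrite mem_cat => /orP[/sX|/rX].
Qed.

Lemma dspan_sum X (I : eqType) (r : seq I) (F : I -> ratfun K n) :
  (forall i, i \in r -> dspan X (F i)) -> dspan X (\sum_(i <- r) F i).
Proof.
elim: r => [|i r IHr] XF; first by exists [::]; rewrite ?big_nil.
rewrite big_cons; apply: dspanD; first by apply: XF; rewrite mem_head.
by apply: IHr => j jr; apply: XF; rewrite inE jr orbT.
Qed.

Lemma dplus_mulD M f g : dplus_mul M f -> dplus_mul M g -> dplus_mul M (f + g).
Proof.
move=> [s sM ->] [r rM ->]; exists (s ++ r); last by rewrite big_cat.
by move=> u; rewrite mem_cat => /orP[/sM|/rM].
Qed.

Lemma dplus_mul_sum M (I : eqType) (r : seq I) (F : I -> ratfun K n) :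
  (forall i, i \in r -> dplus_mul M (F i)) -> dplus_mul M (\sum_(i <- r) F i).
Proof.
elim: r => [|i r IHr] MF; first by exists [::]; rewrite ?big_nil.
rewrite big_cons; apply: dplus_mulD; first by apply: MF; rewrite mem_head.
by apply: IHr => j jr; apply: MF; rewrite inE jr orbT.
Qed.

Lemma dplus_mulZ M (c : K) f :
  (forall g, M g -> M (c *: g)) -> dplus_mul M f -> dplus_mul M (c *: f).
Proof.
move=> cM [s sM ->]; exists [seq (u.1, c *: u.2) | u <- s].
  by move=> _ /mapP[u us ->]; have [? /cM] := sM _ us.
by rewrite big_map scaler_sumr; apply: eq_bigr => u _; rewrite dactZ.
Qed.

Lemma dplus_mul_pderiv M i f : M f -> dplus_mul M (pderiv i f).
Proof.
move=> Mf; exists [:: ('X_i, f)]; last by rewrite big_seq1 dactX.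
by move=> u; rewrite inE => /eqP->; split=> //; exact: dplusX.
Qed.

(** If [b] were not among the vectors of [s], moving it to the other side would give a relation in
    which it has coefficient -1. *)
Lemma Kfree_mem X (s : seq (K * ratfun K n)) b :
  Kfree X -> X b -> (forall u, u \in s -> X u.2) ->
  b = \sum_(u <- s) u.1 *: u.2 -> b \in [seq u.2 | u <- s].
Proof.
move=> freeX Xb sX bE; apply/negPn/negP => bs.
pose ys := undup [seq u.2 | u <- s].
(* A vector may occur several times in [s], so its coefficients are added up. *)
pose c f : K := if f == b then -1 else \sum_(u <- s | u.2 == f) u.1.
have bys : b \notin ys by rewrite mem_undup.
have ubys : uniq (b :: ys) by rewrite /= bys undup_uniq.
have bysX f : f \in b :: ys -> X f.
  by rewrite inE mem_undup => /predU1P[->//|/mapP[u /sX Xu ->]].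
suff s0 : \sum_(f <- b :: ys) c f *: f = 0.
  have := freeX _ c ubys bysX s0 b (mem_head _ _).
  by rewrite /c eqxx => /eqP; rewrite oppr_eq0 oner_eq0.
rewrite big_cons /c eqxx scaleN1r; apply/eqP; rewrite addrC subr_eq0; apply/eqP.
rewrite [RHS]bE; transitivity (\sum_(f <- ys) \sum_(u <- s | u.2 == f) u.1 *: u.2).
  rewrite big_seq [RHS]big_seq; apply: eq_bigr => f fys.
  rewrite ifN; last by apply: contraNneq bys => <-.
  by rewrite scaler_suml; apply: eq_bigr => u /eqP->.
rewrite (exchange_big_dep xpredT) //= big_seq [RHS]big_seq; apply: eq_bigr => u us.
rewrite big_mkcond (bigD1_seq u.2) ?undup_uniq ?mem_undup ?map_f //= eqxx big1 ?addr0 //.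
by move=> f; rewrite eq_sym => /negPf->.
Qed.

End Closure.

(** * The module structure of C *)

Section Reciprocals.
Context {K : fieldType} (charK : [pchar K] =i pred0) {V : vectType K} {n : nat}.
Context {x : n.-tuple 'Hom(V, K^o)} (basis_x : basis_of fullv x).
Context {Delta : {fset 'Hom(V, K^o)}} (Delta0 : forall a, a \in Delta -> a != 0).
Local Notation U := 'Hom(V, K^o).
Local Notation C := (recip_alg x Delta).
Local Notation monomial P :=
  (fun f => exists E, [/\ tuple_in Delta E, P E & f = inv_prod x E]).
Implicit Types (f g : ratfun K n) (E F : seq U).

Let tuple_neq0 E : tuple_in Delta E -> {in E, forall a, a != 0}.
Proof. by move=> ED a /ED; exact: Delta0. Qed.

Let tuple_cons a E : a \in E -> tuple_in Delta E -> tuple_in Delta (a :: E).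
Proof. by move=> aE ED b; rewrite inE => /predU1P[->|]; exact: ED. Qed.

Let tuple_cat E F : tuple_in Delta E -> tuple_in Delta F -> tuple_in Delta (E ++ F).
Proof. by move=> ED FD a; rewrite mem_cat => /orP[/ED|/FD]. Qed.

(** Concatenating tuples multiplies inverse products, so their span is already an algebra; the empty
    tuple gives the constants. *)
Lemma recip_algP f : C f <-> Kspan (monomial predT) f.
Proof.
split.
  elim=> {f} [c|f [a aD ->]|f g _ Cf _ Cg|f g _ Cf _ Cg].
  - apply/KspanZ/Kspan_gen; exists [::]; split=> //.
    by rewrite /inv_prod big_nil invr1.
  - apply: Kspan_gen; exists [:: a]; split=> // [b|].
      by rewrite inE => /eqP->.
    by rewrite /inv_prod big_seq1.
  - exact: KspanD.
  - apply: Kspan_mul Cf Cg => f1 g1 [E [ED _ ->]] [F [FD _ ->]].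
    apply: Kspan_gen; exists (E ++ F); split=> //; first exact: tuple_cat.
    by rewrite inv_prod_cat.
move=> [s sE ->]; elim: s sE => [|u s IHs] sE.
  by rewrite big_nil -(scale0r 1); exact: Kalg_cst.
rewrite big_cons; apply: Kalg_add; last by apply: IHs => w ws; apply: sE; rewrite inE ws orbT.
have [E [ED _ ->]] := sE u (mem_head _ _).
rewrite -[inv_prod x E]mul1r scalerAl; apply: Kalg_mul; first exact: Kalg_cst.
elim: E ED => [|a E IHE] ED.
  by rewrite /inv_prod big_nil invr1 -(scale1r 1); exact: Kalg_cst.
rewrite inv_prod_cons; apply: Kalg_mul.
  by apply: Kalg_gen; exists a => //; apply: ED; exact: mem_head.
by apply: IHE => b bE; apply: ED; rewrite inE bE orbT.
Qed.

Lemma monomial_alg (P : seq U -> Prop) f : Kspan (monomial P) f -> C f.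
Proof.
move=> Pf; apply/recip_algP; apply: Kspan_sub Pf => g [E [ED _ gE]].
by apply: Kspan_gen; exists E.
Qed.

Lemma recip_algD f g : C f -> C g -> C (f + g).
Proof. exact: Kalg_add. Qed.

Lemma recip_algZ (c : K) f : C f -> C (c *: f).
Proof. by move=> /recip_algP Cf; apply/recip_algP/KspanZ. Qed.

Lemma dep_span_alg f : dep_span x Delta f -> C f.
Proof. exact: monomial_alg. Qed.

Lemma AO_alg f : AO x Delta f -> C f.
Proof. exact: monomial_alg. Qed.

Lemma recip_alg_split f : C f ->
  exists g h, [/\ dep_span x Delta g, AO x Delta h & f = g + h].
Proof.
move=> /recip_algP[s sE ->]; elim: s sE => [|u s IHs] sE.
  by exists 0, 0; rewrite big_nil addr0; split=> //; exact: Kspan0.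
have [|g [h [dg ah sumE]]] := IHs; first by move=> w ws; apply: sE; rewrite inE ws orbT.
have [E [ED _ uE]] := sE u (mem_head _ _); rewrite big_cons sumE.
case freeE: (free E).
  exists g, (u.1 *: u.2 + h); split=> //; last by rewrite addrCA.
  by apply: KspanD => //; apply/KspanZ/Kspan_gen; exists E.
exists (u.1 *: u.2 + g), h; split=> //; last by rewrite addrA.
by apply: KspanD => //; apply/KspanZ/Kspan_gen; exists E; rewrite freeE.
Qed.

Lemma pderiv_dirder i f : pderiv i f = dirder (fun k => (k == i)%:R) f.
Proof.
rewrite /dirder (bigD1 i) //= eqxx scale1r big1 ?addr0 // => k /negPf->.
exact: scale0r.
Qed.

Lemma pderiv_dep i f : C f -> dep_span x Delta (pderiv i f).
Proof.
move=> /recip_algP[s sE ->]; rewrite pderiv_sum; apply: Kspan_sum => u /sE[E [ED _ ->]].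
rewrite pderivZ; apply: KspanZ; rewrite pderiv_dirder (dirder_inv_prod basis_x) //; last first.
  exact: tuple_neq0.
rewrite -scaleN1r; apply/KspanZ/Kspan_sum => b bE; apply/KspanZ/Kspan_gen.
exists (b :: E); split=> //; first exact: tuple_cons.
by rewrite free_cons negb_and negbK memv_span.
Qed.

Lemma pderivm_alg m f : C f -> C (pderivm m f).
Proof. by apply: pderivm_closed => i g Cg; exact/dep_span_alg/pderiv_dep. Qed.

Lemma pderivm_dep m f : m != 0%MM -> C f -> dep_span x Delta (pderivm m f).
Proof.
move=> /(pderivm_neq0 m f)[i [m' ->]] Cf; apply: pderiv_dep.
exact: pderivm_alg.
Qed.

(** Every nonconstant monomial of [P] ends with some [pderiv i], which maps C into [dep_span]. *)
Lemma dact_dep P f : C f -> dep_span x Delta (dact P f - P@_0%MM *: f).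
Proof.
move=> Cf; rewrite /dact; have [P0|P0] := boolP (0%MM \in msupp P).
  rewrite (bigD1_seq 0%MM) ?msupp_uniq //= pderivm0 addrAC subrr add0r -big_filter.
  apply: Kspan_sum => m; rewrite mem_filter => /andP[m0 _].
  by apply: KspanZ; exact: pderivm_dep.
rewrite (memN_msupp_eq0 P0) scale0r subr0; apply: Kspan_sum => m mP.
by apply/KspanZ/pderivm_dep => //; apply: contraNneq P0 => <-.
Qed.

Lemma dact_alg P f : C f -> C (dact P f).
Proof.
move=> Cf; rewrite -[dact P f](subrK (P@_0%MM *: f)); apply: recip_algD.
  exact/dep_span_alg/dact_dep.
exact: recip_algZ.
Qed.

Lemma dplus_mul_dep f : dplus_mul C f -> dep_span x Delta f.
Proof.
move=> [s sC ->]; apply: Kspan_sum => u /sC[/dplus_mcoeff0 u0 Cu].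
by have := dact_dep u.1 _ Cu; rewrite u0 scale0r subr0.
Qed.

Lemma inv_prod_alg E : tuple_in Delta E -> C (inv_prod x E).
Proof. by move=> ED; apply/recip_algP/Kspan_gen; exists E. Qed.

Lemma dep_dplus_mul f : dep_span x Delta f -> dplus_mul C f.
Proof.
move=> [s sE ->]; apply: dplus_mul_sum => u /sE[E [ED depE ->]].
apply: dplus_mulZ; first by move=> g; exact: recip_algZ.
have [r rF ->] := dep_span_repeated basis_x Delta Delta0 E ED depE.
apply: dplus_mul_sum => w /rF[F [FD freeF nuF ->]].
apply: dplus_mulZ; first by move=> g; exact: recip_algZ.
have [a [v [c [aF _ ->]]]] := inv_prod_dirder basis_x F charK (tuple_neq0 _ FD) freeF nuF.
apply: dplus_mulZ; first by move=> g; exact: recip_algZ.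
apply: dplus_mul_sum => i _; apply: dplus_mulZ; first by move=> g; exact: recip_algZ.
by apply/dplus_mul_pderiv/inv_prod_alg => b /mem_rem/FD.
Qed.

(** Keeps the tuples themselves, not only their inverse products, because [free_part_eq0] sorts the
    terms by tuple. *)
Lemma monomial_comb (P : seq U -> Prop) f : Kspan (monomial P) f ->
  exists2 s : seq (K * seq U), forall u, u \in s -> tuple_in Delta u.2 /\ P u.2
    & f = \sum_(u <- s) u.1 *: inv_prod x u.2.
Proof.
move=> [s sP ->]; elim: s sP => [|u s IHs] sP; first by exists [::]; rewrite ?big_nil.
have [|r rP rE] := IHs; first by move=> w ws; apply: sP; rewrite inE ws orbT.
have [E [ED PE uE]] := sP u (mem_head _ _).
exists ((u.1, E) :: r); last by rewrite !big_cons rE uE.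
by move=> w; rewrite inE => /predU1P[->|/rP].
Qed.

Lemma of_poly_inj : injective (@of_poly K n).
Proof. by move=> p q /eqP; rewrite of_poly_eq => /eqP. Qed.

(** Subtracting the two expansions of [f] gives a relation whose free terms are exactly those of the
    AO expansion; [free_part_eq0] makes their sum, which is [f], vanish. *)
Lemma AO_dep_eq0 f : AO x Delta f -> dep_span x Delta f -> f = 0.
Proof.
move=> /monomial_comb[s sP fs] /monomial_comb[r rP fr].
pose r' := [seq (- u.1, u.2) | u <- r].
have sum0 : \sum_(u <- s ++ r') u.1 *: inv_prod x u.2 = 0.
  rewrite big_cat big_map /= -fs fr -big_split big1 // => u _.
  by rewrite /= scaleNr subrr.
have sr0 : {in s ++ r', forall u, {in u.2, forall a, a != 0}}.
  move=> u; rewrite mem_cat => /orP[/sP[uD _]|/mapP[w /rP[wD _] ->]] /=; exact: tuple_neq0.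
have := free_part_eq0 basis_x (@of_poly K n) of_poly_inj _ sr0 sum0.
rewrite big_cat /= [X in _ + X = _]big_seq_cond [X in _ + X = _]big1 ?addr0; last first.
  by move=> u /andP[/mapP[w /rP[_ /negPf depw] ->]]; rewrite /= depw.
move=> s_eq0; rewrite fs big_seq -[RHS]s_eq0 [RHS]big_seq_cond.
by apply: eq_bigl => u; case us: (u \in s) => //=; have [_ ->] := sP _ us.
Qed.

(** After the exchange, a tuple with a repetition is a derivative of a shorter one with the same
    underlying set, so induction on the size reaches independent tuples. *)
Lemma recip_alg_pderivm f : C f ->
  Kspan (fun f => exists m E, [/\ tuple_in Delta E, free E
           & f = pderivm m (inv_prod x E)]) f.
Proof.
set X := (X in Kspan X).
have Xd i g : Kspan X g -> Kspan X (pderiv i g).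
  apply: Kspan_pderiv => {}g [m [E [ED freeE ->]]]; apply: Kspan_gen.
  by exists (m + U_(i))%MM, E; rewrite pderivmSU.
have Xfree E : tuple_in Delta E -> free E -> Kspan X (inv_prod x E).
  by move=> ED freeE; apply: Kspan_gen; exists 0%MM, E; rewrite pderivm0.
have Xundup F : tuple_in Delta F -> free (undup F) -> Kspan X (inv_prod x F).
  have [N] := ubnP (size F); elim: N F => // N IHN F ltFN FD freeF.
  have [uF|nuF] := boolP (uniq F).
    by move: freeF; rewrite undup_id //; exact: Xfree.
  have [a [v [c [aF pF ->]]]] := inv_prod_dirder basis_x F charK (tuple_neq0 _ FD) freeF nuF.
  apply/KspanZ/Kspan_sum => i _; apply/KspanZ/Xd/IHN.
  - by rewrite size_rem // -ltnS prednK //; case: (F) aF.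
  - by move=> b /mem_rem/FD.
  - by rewrite (perm_free pF).
move=> /recip_algP; apply: Kspan_sub => g [E [ED _ ->]].
have [freeE|depE] := boolP (free E); first exact: Xfree.
have := dep_span_repeated basis_x Delta Delta0 E ED depE.
by apply: Kspan_sub => h [F [FD freeF _ ->]]; exact: Xundup.
Qed.

Section Basis.
Context {B : ratfun K n -> Prop} (basis_B : Kbasis (AO x Delta) B).

Lemma basis_AO b : B b -> AO x Delta b.
Proof. by move=> Bb; apply/basis_B.2/Kspan_gen. Qed.

Lemma recip_alg_dspan f : C f <-> dspan B f.
Proof.
split=> [/recip_alg_pderivm[s sX ->]|[s sB ->]].
  apply: dspan_sum => u /sX[m [E [ED freeE ->]]].
  have /basis_B.2[r rB ->] : AO x Delta (inv_prod x E) by apply: Kspan_gen; exists E.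
  rewrite pderivm_comb scaler_sumr; apply: dspan_sum => w /rB Bw.
  exists [:: ((u.1 * w.1) *: 'X_[m], w.2)]; last by rewrite big_seq1 dactZX scalerA.
  by move=> p; rewrite inE => /eqP->.
apply/recip_algP; apply: Kspan_sum => u /sB/basis_AO/AO_alg Cu.
by apply/recip_algP/dact_alg.
Qed.

Lemma basis_minimal (Y : ratfun K n -> Prop) : (forall f, Y f -> B f) ->
  (forall f, C f <-> dspan Y f) -> forall b, B b -> Y b.
Proof.
move=> YB CY b Bb; have /CY[s sY bE] := AO_alg _ (basis_AO _ Bb).
(* Each operator is replaced by its constant term, its action modulo [dep_span]. *)
pose r := [seq (u.1@_0%MM, u.2) | u <- s].
suff : b \in [seq u.2 | u <- r] by move=> /mapP[_ /mapP[u /sY Yu ->] ->].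
have rB u : u \in r -> B u.2 by move=> /mapP[w /sY/YB Bw ->].
apply: (Kfree_mem _ _ _ basis_B.1 Bb rB); apply/eqP; rewrite -subr_eq0; apply/eqP.
(* [b] and the combination given by [r] both lie in AO and differ by an element of [dep_span], so
   they are equal. *)
apply: AO_dep_eq0.
  apply: KspanB; first exact: basis_AO.
  by apply: Kspan_comb => u /rB; exact: basis_AO.
rewrite {1}bE big_map -sumrB; apply: Kspan_sum => u /sY/YB/basis_AO/AO_alg.
exact: dact_dep.
Qed.

End Basis.

End Reciprocals.

Theorem theorem1p3 (K : fieldType) (charK : [pchar K] =i pred0)
    (l : nat) (V : vectType K) (dimV : \dim (@fullv K V) = l)
    (x : l.-tuple 'Hom(V, K^o))
    (basis_x : basis_of (@fullv K 'Hom(V, K^o)) x)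
    (Delta : {fset 'Hom(V, K^o)})
    (Delta_neq0 : forall a, a \in Delta -> a <> 0)
    (Delta_nprop : forall a b, a \in Delta -> b \in Delta -> a <> b ->
       forall c : K, a <> c *: b)
    (B : ratfun K l -> Prop) (basis_B : Kbasis (AO x Delta) B) :
  let C := recip_alg x Delta in
  [/\ minimal_generators C B,
      direct_sum C (dplus_mul C) (AO x Delta),
      forall f : ratfun K l, dplus_mul C f <-> dep_span x Delta f
    & ideal_of C (dplus_mul C)].
Proof.
have Delta0 a : a \in Delta -> a != 0 by move=> /Delta_neq0/eqP.
move=> C; have depP f : dplus_mul C f <-> dep_span x Delta f.
  split; first exact: dplus_mul_dep.
  exact: dep_dplus_mul.
split=> //.
- split; first by move=> f; exact: recip_alg_dspan.
  by move=> Y YB CY; exact: (basis_minimal basis_x Delta0 basis_B).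
- split=> [f|f /depP df af]; last exact: (AO_dep_eq0 basis_x Delta0).
  split=> [/recip_alg_split[g [h [dg ah ->]]]|[g [h [/depP dg ah ->]]]].
    by exists g, h; split=> //; exact/depP.
  apply: recip_algD; [exact: dep_span_alg|exact: AO_alg].
- split=> [f /depP| |f g /depP df /depP dg|f g Cf /depP dg].
  + exact: dep_span_alg.
  + exact/depP/Kspan0.
  + exact/depP/KspanB.
  apply/depP; move/recip_algP: Cf => Cf.
  apply: Kspan_mul Cf dg => f1 g1 [E [ED _ ->]] [F [FD depF ->]]; apply: Kspan_gen.
  (* Enlarging the dependent tuple [F] keeps it dependent, which makes [dep_span] an ideal. *)
  exists (E ++ F); rewrite inv_prod_cat; split=> //.
    by move=> a; rewrite mem_cat => /orP[/ED|/FD].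
  by apply: contraNN depF; exact: catr_free.
Qed.
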